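(* Suppose that $\gamma>1$ satisfies $\overline g_{k-1,k}(x)\le\gamma$ for all $x\in E$ and $1\le k\le n$, and that $\alpha\in(0,1)$ and $\beta\in[0,1]$ satisfy, for all $2\le k\le n$ and $f\in B(E)$, $$\|\hat q_{k-1,k}(f)\|_{L_2(\mu_{k-1})}^2\le\alpha\|f\|_{L_2(\mu_k)}^2+\beta\,\mu_k(f)^2 .$$ Let $p\ge1$ and $q\ge1$, let $q\in[2^r,2^{r+1}]$ with $r\in\mathbb{N}=\{0,1,2,\dots\}$, and assume $\alpha\gamma^{2^{r+1}-2}<1$. Assume that there is a constant $\theta(p,q)\ge0$ such that for all $1\le j\le n$ and $f\in B(E)$ $$\|K_j(f)\|_{L_p(\mu_j)}\le\theta(p,q)\,\|f\|_{L_q(\mu_j)} .$$ Then for all $1\le j<k\le n$ and $f\in B(E)$, $$\|q_{j,k}(f)\|_{L_p(\mu_j)}\le\widetilde c_{j,k}(p,q)\,\|f\|_{L_q(\mu_k)},\qquad \widetilde c_{j,k}(p,q)=\theta(p,q)\,\gamma^{\frac{p-1}{p}}\,\gamma^{\frac{q-1}{q}}\,\delta(q),$$ where $$\delta(q)=\prod_{i=1}^{r+1}\frac{\gamma^{1-2^{-(i-1)}}}{(1-\alpha\gamma^{2^i-2})^{2^{-i}}} .$$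
   Context: $E$ is a Polish space, $B(E)$ the bounded measurable real functions on $E$, $\mu(f)=\int f\,d\mu$, $\|f\|_{L_p(\mu)}=\mu(|f|^p)^{1/p}$, and $K(f)(x)=\int f(z)K(x,dz)$ for a kernel $K$. $\mu_0,\dots,\mu_n$ are probability measures on $E$; for $1\le k\le n$, $K_k$ is a Markov transition kernel on $E$ with stationary distribution $\mu_k$ ($\mu_kK_k=\mu_k$), and $g_{k-1,k}\in B(E)$ is positive with $\mu_k(f)=\mu_{k-1}(g_{k-1,k}f)/\mu_{k-1}(g_{k-1,k})$ for all $f\in B(E)$. Put $\overline g_{k-1,k}=g_{k-1,k}/\mu_{k-1}(g_{k-1,k})$. Feynman-Kac propagator: $q_{k-1,k}(f)=\overline g_{k-1,k}K_k(f)$ for $1\le k\le n$, $q_{j,k}=q_{j,j+1}\circ\cdots\circ q_{k-1,k}$ for $0\le j<k\le n$, $q_{k,k}(f)=f$. Modified one-step propagator: $\hat q_{k-1,k}(f)=K_{k-1}(\overline g_{k-1,k}f)$ for $2\le k\le n$. *)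

(* Defs.v *)
From HB Require Import structures.
From mathcomp Require Import all_boot all_order all_algebra.
From mathcomp Require Import all_classical all_reals all_analysis.
Set Implicit Arguments.
Unset Strict Implicit.
Unset Printing Implicit Defensive.
Import Order.TTheory GRing.Theory Num.Theory.
Import numFieldNormedType.Exports.
Local Open Scope classical_set_scope.
Local Open Scope ring_scope.

Definition metric_on (R : realType) (T : Type) (d : T -> T -> R) : Prop :=
  [/\ forall x y, d x y = 0 <-> x = y,
      forall x y, 0 <= d x y,
      forall x y, d x y = d y x &
      forall x y z, d x z <= d x y + d y z].

Definition metrizes (R : realType) (T : topologicalType) (d : T -> T -> R) :
    Prop :=
  forall (x : T) (A : set T),
    nbhs x A <-> exists2 e : R, 0 < e & [set y | d x y < e] `<=` A.

Definition complete_metric (R : realType) (T : topologicalType)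
    (d : T -> T -> R) : Prop :=
  forall u : nat -> T,
    (forall e : R, 0 < e -> exists N : nat, forall m n : nat,
       (N <= m)%N -> (N <= n)%N -> d (u m) (u n) < e) ->
    exists l : T, u @ \oo --> l.

(* R only serves as the codomain of the metric. *)
Definition polish (R : realType) (T : topologicalType) : Prop :=
  (exists2 D : set T, countable D & dense D) /\
  (exists d : T -> T -> R, [/\ metric_on d, metrizes d & complete_metric d]).

Notation borel T := (g_sigma_algebraType (@open T)).

Section FeynmanKac.
Context (R : realType) (d : measure_display) (E : measurableType d).
Implicit Types (f : E -> R) (mu : nat -> probability E R).

Definition bounded_measurable f : Prop :=
  measurable_fun setT f /\ exists M : R, forall x, `|f x| <= M.

Definition Kint (K : R.-pker E ~> E) f : E -> R := fun x => \int[K x]_z f z.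

Definition stationary (nu : probability E R) (K : R.-pker E ~> E) : Prop :=
  forall A : set E, measurable A -> (\int[nu]_x K x A = nu A)%E.

(* Families indexed by nat: g k stands for g_{k-1,k}, and likewise
   gbar mu g k, qstep mu g K k and qhat mu g K k carry the pair (k-1, k); only
   k >= 1 is meaningful (k >= 2 for qhat). *)
Definition gbar mu (g : nat -> E -> R) (k : nat) : E -> R :=
  fun x => g k x / \int[mu k.-1]_y g k y.

Definition qstep mu (g : nat -> E -> R) (K : nat -> R.-pker E ~> E) (k : nat)
    f : E -> R :=
  fun x => gbar mu g k x * Kint (K k) f x.

(* q_{j,k} f = q_{j,j+1} (q_{j+1,j+2} (... (q_{k-1,k} f))), and f if j = k. *)
Definition qprop mu (g : nat -> E -> R) (K : nat -> R.-pker E ~> E)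
    (j k : nat) f : E -> R :=
  foldr (qstep mu g K) f (iota j.+1 (k - j)).

Definition qhat mu (g : nat -> E -> R) (K : nat -> R.-pker E ~> E) (k : nat)
    f : E -> R :=
  Kint (K k.-1) (fun x => gbar mu g k x * f x).

End FeynmanKac.

(* delta(q) depends on q only through r, where 2^r <= q <= 2^(r+1). *)
Definition delta (R : realType) (alpha gamma : R) (r : nat) : R :=
  \prod_(1 <= i < r.+2)
    (gamma `^ (1 - 2 ^- i.-1) /
     (1 - alpha * gamma ^+ (2 ^ i - 2)) `^ (2 ^- i)).

Definition ctilde (R : realType) (alpha gamma theta p q : R) (r : nat) : R :=
  theta * gamma `^ ((p - 1) / p) * gamma `^ ((q - 1) / q) *
  delta alpha gamma r.

(* Main.v *)
(* Regrouping the factors, q_{j,k} f = gbar_{j+1} qhat_{j+1,k} (K_k f), where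
   qhat_{j,k} is the product of the modified one-step propagators. Jensen's
   inequality |qhat f|^p <= gamma^(p-1) qhat (|f|^p) turns the L_2 hypothesis
   into a recursion for the L_{2p} norm of qhat_{j,k} f with an L_p source term,
   so L_{2^i} bounds follow by induction on i from the trivial L_1 bound;
   interpolation reaches every q between 2^r and 2^(r+1). In q_{j,k} the leftmost
   kernel supplies theta, and each of the two leftmost weights costs, by a change
   of measure, a power of gamma. *)
Require Import Defs.
From HB Require Import structures.
From mathcomp Require Import all_boot all_order all_algebra.
From mathcomp Require Import all_classical all_reals all_analysis.
From mathcomp Require Import measurable_realfun.
From mathcomp Require Import ring lra zify.
Import Order.TTheory GRing.Theory Num.Theory.
Import numFieldNormedType.Exports.
Local Open Scope classical_set_scope.
Local Open Scope ring_scope.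

(** * Closure properties and integrability of bounded measurable functions *)

Section BoundedMeasurable.
Context {R : realType} {d : measure_display} {E : measurableType d}.
Implicit Types f h : E -> R.

Lemma bm_cst (c : R) : bounded_measurable (fun _ : E => c).
Proof. by split; [exact: measurable_cst | exists `|c|]. Qed.

Lemma bmD f h : bounded_measurable f -> bounded_measurable h ->
  bounded_measurable (fun x => f x + h x).
Proof.
move=> [mf [M fM]] [mh [N hN]]; split; first exact: measurable_funD.
by exists (M + N) => x; rewrite (le_trans (ler_normD _ _))// lerD.
Qed.

Lemma bmM f h : bounded_measurable f -> bounded_measurable h ->
  bounded_measurable (fun x => f x * h x).
Proof.
move=> [mf [M fM]] [mh [N hN]]; split; first exact: measurable_funM.
by exists (M * N) => x; rewrite normrM ler_pM.
Qed.

Lemma bm_norm f : bounded_measurable f -> bounded_measurable (fun x => `|f x|).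
Proof.
move=> [mf [M fM]]; split; first exact: measurableT_comp.
by exists M => x; rewrite normr_id.
Qed.

Lemma bm_powR (s : R) f : 0 <= s -> bounded_measurable f ->
  (forall x, 0 <= f x) -> bounded_measurable (fun x => f x `^ s).
Proof.
move=> s0 [mf [M fM]] f0; split; first exact: (measurableT_comp (measurable_powR s) mf).
exists (M `^ s) => x; rewrite ger0_norm ?powR_ge0// ge0_ler_powR ?nnegrE//.
  exact: le_trans (fM x).
by rewrite (le_trans _ (fM x))// ler_norm.
Qed.

Lemma bm_integrable (nu : {measure set E -> \bar R}) f :
  (nu setT < +oo)%E -> bounded_measurable f -> nu.-integrable setT (EFin \o f).
Proof.
move=> nuT [mf [M fM]]; apply: measurable_bounded_integrable => //.
exists M; split; first exact: num_real.
by move=> N MN x _; exact: le_trans (fM x) (ltW MN).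
Qed.

End BoundedMeasurable.

(** * Positive linear functionals: Young, Hoelder and Jensen inequalities *)

Section PositiveLinear.
Context {R : realType} {d : measure_display} {E : measurableType d}.
Implicit Types (f h : E -> R) (L : (E -> R) -> R).

(** Covers both integration against a measure and evaluation of a kernel or propagator at a point,
    so that Hoelder and Jensen are proved once for all of them. *)
Definition pos_linear L : Prop :=
  (forall (a : R) f h, bounded_measurable f -> bounded_measurable h ->
     L (fun x => a * f x + h x) = a * L f + L h) /\
  (forall f, bounded_measurable f -> (forall x, 0 <= f x) -> 0 <= L f).

Lemma pos_linear0 L : pos_linear L -> L (fun=> 0) = 0.
Proof.
(* Linearity with [a = -1] and both functions zero reads [L 0 = - L 0 + L 0]. *)
move=> [lin _]; have := lin (-1) _ _ (bm_cst 0) (bm_cst 0).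
by under eq_fun do rewrite mulr0 addr0; rewrite mulN1r addNr.
Qed.

Lemma pos_linearZ L (a : R) f : pos_linear L -> bounded_measurable f ->
  L (fun x => a * f x) = a * L f.
Proof.
move=> hL bf; have := hL.1 a _ _ bf (bm_cst 0).
by under eq_fun do rewrite addr0; rewrite pos_linear0// addr0.
Qed.

Lemma pos_linear_le L f h : pos_linear L ->
  bounded_measurable f -> bounded_measurable h ->
  (forall x, f x <= h x) -> L f <= L h.
Proof.
move=> [lin pos] bf bh fh.
have : 0 <= L (fun x => -1 * f x + h x).
  apply: pos => [|x]; first by apply: bmD => //; apply: bmM => //; exact: bm_cst.
  by rewrite mulN1r addrC subr_ge0.
by rewrite lin// mulN1r addrC subr_ge0.
Qed.

Lemma pos_linear_norm L f : pos_linear L -> bounded_measurable f ->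
  `|L f| <= L (fun x => `|f x|).
Proof.
move=> hL bf; rewrite ler_norml; apply/andP; split.
  rewrite -mulN1r -pos_linearZ//; last exact: bm_norm.
  apply: pos_linear_le => //; first by apply: bmM;
    [exact: bm_cst|exact: bm_norm].
  by move=> x; rewrite mulN1r lerNl ler_normr lexx orbT.
by apply: pos_linear_le => // [|x]; [exact: bm_norm|exact: ler_norm].
Qed.

Lemma pos_linear_finite_measure (nu : {measure set E -> \bar R}) :
  (nu setT < +oo)%E -> pos_linear (fun f => \int[nu]_x f x).
Proof.
move=> nuT; split=> [a f h bf bh|f bf f0]; last by apply: Rintegral_ge0 => x _.
rewrite RintegralD//; last 2 first.
- by apply: bm_integrable => //; apply: bmM => //; exact: bm_cst.
- exact: bm_integrable.
by rewrite RintegralZl//; exact: bm_integrable.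
Qed.

Lemma probability_setT_lty (nu : probability E R) : (nu setT < +oo)%E.
Proof. by apply: (le_lt_trans (probability_le1 nu measurableT)); rewrite ltry. Qed.

Lemma pos_linear_Rintegral (nu : probability E R) :
  pos_linear (fun f => \int[nu]_x f x).
Proof. exact/pos_linear_finite_measure/probability_setT_lty. Qed.

(** Young's inequality for [l^(-t) a] and [l^(1-t) b]: the weighted geometric mean does not depend
    on [l], which stays free for a later choice. *)
Lemma weighted_young (t a b l : R) : 0 < t < 1 -> 0 <= a -> 0 <= b -> 0 < l ->
  a `^ (1 - t) * b `^ t <= (1 - t) * l `^ (- t) * a + t * l `^ (1 - t) * b.
Proof.
move=> /andP[t0 t1] a0 b0 l0.
have t1' : 0 < 1 - t by rewrite subr_gt0.
have := @conjugate_powR R ((l `^ (- t) * a) `^ (1 - t))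
  ((l `^ (1 - t) * b) `^ t) (1 - t)^-1 t^-1 (powR_ge0 _ _) (powR_ge0 _ _).
rewrite !invr_gt0 !invrK => /(_ t1' t0 (subrK _ _)).
have la : 0 <= l `^ (- t) * a by rewrite mulr_ge0 ?powR_ge0.
have lb : 0 <= l `^ (1 - t) * b by rewrite mulr_ge0 ?powR_ge0.
rewrite -!powRrM !mulfV ?gt_eqF// !powRr1//.
rewrite !powRM ?powR_ge0// -!powRrM mulrACA -powRD; last first.
  by rewrite (gt_eqF l0) implybT.
rewrite (_ : - t * (1 - t) + (1 - t) * t = 0); last by ring.
by rewrite powRr0 mul1r; congr (_ <= _); ring.
Qed.

Lemma bm_powR_prod (t : R) f h : 0 <= t <= 1 ->
  bounded_measurable f -> bounded_measurable h ->
  (forall x, 0 <= f x) -> (forall x, 0 <= h x) ->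
  bounded_measurable (fun x => f x `^ (1 - t) * h x `^ t).
Proof.
move=> /andP[t0 t1] bf bh f0 h0.
by apply: bmM; apply: bm_powR => //; rewrite subr_ge0.
Qed.

Lemma pos_linear_young L (t l : R) f h : pos_linear L ->
  0 < t < 1 -> 0 < l -> bounded_measurable f -> bounded_measurable h ->
  (forall x, 0 <= f x) -> (forall x, 0 <= h x) ->
  L (fun x => f x `^ (1 - t) * h x `^ t) <=
  (1 - t) * l `^ (- t) * L f + t * l `^ (1 - t) * L h.
Proof.
move=> hL t01 l0 bf bh f0 h0.
have bh' : bounded_measurable (fun x => t * l `^ (1 - t) * h x).
  by apply: bmM => //; exact: bm_cst.
rewrite -(pos_linearZ _ (t * l `^ (1 - t)) _ hL bh) -hL.1//.
apply: pos_linear_le => //.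
- by move/andP : t01 => [? ?]; apply: bm_powR_prod; rewrite ?ltW.
- by apply: bmD => //; apply: bmM => //; exact: bm_cst.
- by move=> x; exact: weighted_young.
Qed.

(* Letting l tend to 0 in the Young bound. *)
Lemma pos_linear_hoelder0 L (t : R) f h : pos_linear L ->
  0 < t < 1 -> bounded_measurable f -> bounded_measurable h ->
  (forall x, 0 <= f x) -> (forall x, 0 <= h x) -> L f = 0 ->
  L (fun x => f x `^ (1 - t) * h x `^ t) <= 0.
Proof.
move=> hL t01 bf bh f0 h0 Lf; apply/ler_addgt0Pr => e e0; rewrite add0r.
have Lh : 0 <= L h by exact: hL.2.
have [t0 t1] := andP t01.
have t1' : 0 < 1 - t by rewrite subr_gt0.
have c0 : 0 < e / (L h + 1) by rewrite divr_gt0// ltr_wpDl.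
(* This [l] satisfies [l^(1-t) = e / (L h + 1)], so the surviving Young term is at most [e]; the
   [+ 1] keeps the quotient meaningful when [L h = 0]. *)
have l0 : 0 < (e / (L h + 1)) `^ (1 - t)^-1 by exact: powR_gt0.
apply: (le_trans (pos_linear_young _ _ _ _ _ hL t01 l0 bf bh f0 h0)).
rewrite Lf mulr0 add0r -powRrM mulVf ?gt_eqF// (powRr1 (ltW c0)).
rewrite -mulrA -[leRHS]mul1r ler_pM// ?(ltW t0) ?(ltW t1)//.
  by rewrite mulr_ge0 ?(ltW c0).
by rewrite mulrAC ler_pdivrMr ?ltr_wpDl// ler_pM2l// lerDl.
Qed.

(** The endpoints [t = 0, 1] are trivial and a vanishing [L f] or [L h] is the degenerate case;
    otherwise the Young bound is optimized over [l]. *)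
Lemma pos_linear_hoelder L (t : R) f h : pos_linear L ->
  0 <= t <= 1 -> bounded_measurable f -> bounded_measurable h ->
  (forall x, 0 <= f x) -> (forall x, 0 <= h x) ->
  L (fun x => f x `^ (1 - t) * h x `^ t) <= L f `^ (1 - t) * L h `^ t.
Proof.
move=> hL /andP[]; rewrite le_eqVlt => /predU1P[<- _|t0].
  move=> bf bh f0 h0; rewrite subr0 powRr0 mulr1 powRr1; last exact: hL.2.
  by under eq_fun do rewrite powRr0 mulr1 powRr1//.
rewrite le_eqVlt => /predU1P[->|t1] bf bh f0 h0.
  rewrite subrr powRr0 mul1r powRr1; last exact: hL.2.
  by under eq_fun do rewrite powRr0 mul1r powRr1//.
have t01 : 0 < t < 1 by rewrite t0.
have rhs0 : 0 <= L f `^ (1 - t) * L h `^ t by rewrite mulr_ge0 ?powR_ge0.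
have := hL.2 f bf f0; rewrite le_eqVlt => /predU1P[Lf|Lf].
  exact: le_trans (pos_linear_hoelder0 _ _ _ _ hL t01 bf bh f0 h0 (esym Lf)) _.
have := hL.2 h bh h0; rewrite le_eqVlt => /predU1P[Lh|Lh].
  (* The case [L h = 0] is the case [L f = 0] with [f], [h] and [t], [1 - t] exchanged. *)
  have t01' : 0 < 1 - t < 1 by rewrite subr_gt0 t1 ltrBlDr ltrDl.
  apply: le_trans _ rhs0.
  have := pos_linear_hoelder0 _ _ _ _ hL t01' bh bf h0 f0 (esym Lh).
  by rewrite (_ : 1 - (1 - t) = t); [under eq_fun do rewrite mulrC|ring].
(* The minimizer of the Young bound: both terms become multiples of [L f ^ (1-t) * L h ^ t], with
   weights [1 - t] and [t]. *)
have l0 : 0 < L f / L h by rewrite divr_gt0.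
apply: (le_trans (pos_linear_young _ _ _ _ _ hL t01 l0 bf bh f0 h0)).
rewrite !powRM ?invr_ge0 ?(ltW Lf) ?(ltW Lh)// -!(powR_inv1 (ltW Lh)) -!powRrM.
set A := L f in Lf *; set B := L h in Lh *.
have -> : (1 - t) * (A `^ (- t) * B `^ (-1 * - t)) * A =
    (1 - t) * (A `^ (1 - t) * B `^ t).
  rewrite (addrC 1) (@powRD _ _ (- t)) ?(gt_eqF Lf) ?implybT// (powRr1 (ltW Lf)).
  by rewrite (_ : -1 * - t = t); ring.
have -> : t * (A `^ (1 - t) * B `^ (-1 * (1 - t))) * B =
    t * (A `^ (1 - t) * B `^ t).
  rewrite (_ : -1 * (1 - t) = t - 1); last by ring.
  rewrite (@powRD _ B t) ?(gt_eqF Lh) ?implybT// (powR_inv1 (ltW Lh)).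
  by field; rewrite gt_eqF.
by rewrite -mulrDl subrK mul1r.
Qed.

(** Hoelder for [|f|^s] and the constant 1 with [t = 1 - 1/s] gives [L |f| <= (L |f|^s)^(1/s)]. *)
Lemma pos_linear_jensen L (s : R) f : pos_linear L -> L (fun=> 1) = 1 ->
  1 <= s -> bounded_measurable f ->
  `|L f| `^ s <= L (fun x => `|f x| `^ s).
Proof.
move=> hL L1 s1 bf; have s0 : 0 < s by exact: lt_le_trans s1.
have bfs : bounded_measurable (fun x => `|f x| `^ s).
  by apply: bm_powR => //; [exact: ltW|exact: bm_norm].
have fs0 x : 0 <= `|f x| `^ s by exact: powR_ge0.
have Lfs := hL.2 _ bfs fs0.
have s01 : 0 <= 1 - s^-1 <= 1.
  by rewrite subr_ge0 invf_le1// s1/= lerBlDl lerDr invr_ge0 ltW.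
have := pos_linear_hoelder _ _ _ _ hL s01 bfs (bm_cst 1) fs0 (fun=> ler01).
rewrite L1 subKr powR1 mulr1.
under eq_fun do rewrite mulr1 -powRrM mulfV ?gt_eqF// powRr1//.
move=> H; rewrite -[leRHS](powRr1 Lfs) -(mulVf (lt0r_neq0 s0)) powRrM.
rewrite ge0_ler_powR ?nnegrE ?powR_ge0 ?(ltW s0)//.
exact: le_trans (pos_linear_norm _ _ hL bf) H.
Qed.

End PositiveLinear.

(** * Moments of bounded measurable functions *)

Section Moment.
Context {R : realType} {d : measure_display} {E : measurableType d}.
Implicit Types (f h : E -> R) (nu : probability E R).

(** The [s]-th power of the [L_s] norm, kept as a real number so that the recursions need neither
    roots nor extended reals. *)
Definition moment nu (s : R) f : R := \int[nu]_x (`|f x| `^ s).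

Lemma bm_moment (s : R) f : 0 <= s -> bounded_measurable f ->
  bounded_measurable (fun x => `|f x| `^ s).
Proof. by move=> s0 bf; apply: bm_powR => //; exact: bm_norm. Qed.

Lemma moment_ge0 nu (s : R) f : 0 <= moment nu s f.
Proof. by apply: Rintegral_ge0 => x _; exact: powR_ge0. Qed.

Lemma Lnorm_moment nu (s : R) f : 0 <= s -> bounded_measurable f ->
  ('N[nu]_s%:E[EFin \o f] = (moment nu s f `^ s^-1)%:E)%E.
Proof.
move=> s0 bf; rewrite unlock /moment /Rintegral -poweR_EFin fineK//.
apply: integrable_fin_num => //; apply: bm_integrable.
  exact: probability_setT_lty.
exact: bm_moment.
Qed.

Lemma probability_Rintegral1 nu : \int[nu]_x (fun=> 1 : R) x = 1.
Proof.
rewrite Rintegral_cst// mul1r.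
by have /(congr1 fine) := @probability_setT _ _ _ nu.
Qed.

(** Jensen for [|f|^s] with exponent [t / s]; the case [t = 2 s] later absorbs the source term of
    the recursion. *)
Lemma moment_jensen nu (s t : R) f : 0 < s -> s <= t -> bounded_measurable f ->
  moment nu s f `^ (t / s) <= moment nu t f.
Proof.
move=> s0 st bf.
have ts : 1 <= t / s by rewrite ler_pdivlMr// mul1r.
have := pos_linear_jensen _ (t / s) _ (pos_linear_Rintegral nu)
  (probability_Rintegral1 nu) ts (bm_moment _ _ (ltW s0) bf).
rewrite (ger0_norm (moment_ge0 nu s f)) => /le_trans; apply.
rewrite le_eqVlt; apply/orP; left; apply/eqP; apply: eq_Rintegral => x _.
by rewrite ger0_norm ?powR_ge0// -powRrM mulrC divfK// gt_eqF.
Qed.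

End Moment.

(** * Integration against Markov kernels and stationarity *)

Section Kernel.
Context {R : realType} {d : measure_display} {E : measurableType d}.
Implicit Types (f h : E -> R) (nu : probability E R) (K : R.-pker E ~> E).

Lemma kernel_setT_lty K x : (K x setT < +oo)%E.
Proof. by rewrite prob_kernel ltry. Qed.

Lemma pos_linear_kernel K x : pos_linear (fun f => Kint K f x).
Proof. exact/pos_linear_finite_measure/kernel_setT_lty. Qed.

Lemma Kint_cst K (c : R) x : Kint K (fun=> c) x = c.
Proof. by rewrite /Kint Rintegral_cst// prob_kernel mulr1. Qed.

Lemma Kint_measurable_ge0 K f : bounded_measurable f -> (forall x, 0 <= f x) ->
  measurable_fun setT (Kint K f).
Proof.
move=> [mf _] f0; apply: (measurableT_comp (fine_measurable measurableT)).
apply: measurable_fun_integral_kernel => //.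
- exact: measurable_kernel.
- exact/measurable_EFinP.
Qed.

(** Measurability is reduced to a nonnegative integrand by shifting: [K f = K (f + M) - M] for a
    bound [M] of [|f|], the kernel being Markov. *)
Lemma bm_Kint K f : bounded_measurable f -> bounded_measurable (Kint K f).
Proof.
move=> bf; have [mf [M fM]] := bf.
have bM : bounded_measurable (fun _ : E => M) by exact: bm_cst.
have bfM : bounded_measurable (fun x => f x + M) by exact: bmD.
split; last first.
  exists M => x; apply: le_trans (pos_linear_norm _ _ (pos_linear_kernel K x) bf) _.
  apply: le_trans (pos_linear_le _ _ _ (pos_linear_kernel K x) (bm_norm _ bf) bM fM) _.
  by rewrite Kint_cst.
have -> : Kint K f = (fun x => Kint K (fun x => f x + M) x + - M).
  apply/funext => x.
  have := (pos_linear_kernel K x).1 1 _ _ bf bM.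
  under eq_fun do rewrite mul1r.
  by move=> ->; rewrite mul1r Kint_cst addrK.
apply: measurable_funD => //.
apply: Kint_measurable_ge0 => // x.
by rewrite -lerBlDr sub0r; have := fM x; rewrite ler_norml => /andP[].
Qed.

(** Viewing [nu] as a constant kernel [l], the left side is an integral against the composition of
    [l] with [K], and stationarity says that this composition is [nu]. The base point [point] is
    arbitrary. *)
Lemma stationary_ge0 nu K f : stationary nu K -> bounded_measurable f ->
  (forall x, 0 <= f x) -> \int[nu]_x Kint K f x = \int[nu]_x f x.
Proof.
move=> nuK bf f0; have [mf _] := bf; rewrite /Kint /Rintegral; congr fine.
pose l : R.-sfker E ~> E :=
  kprobability (@measurable_cst _ _ E (pprobability E R) setT nu).
pose k : R.-sfker (E * E) ~> E := kernel.kernel_snd K.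
transitivity (\int[l point]_x \int[k (point, x)]_y (f y)%:E)%E.
  apply: eq_integral => x _; rewrite fineK//.
  apply: integrable_fin_num => //; apply: bm_integrable => //.
  exact: kernel_setT_lty.
rewrite -(integral_kcomp l k point)//; last exact/measurable_EFinP.
apply: eq_measure_integral => A mA _.
exact: nuK.
Qed.

(** The nonnegative case, applied to [f + M] and to the constant [M], leaves the claim for [f] after
    cancellation. *)
Lemma stationary_Rintegral nu K f : stationary nu K -> bounded_measurable f ->
  \int[nu]_x Kint K f x = \int[nu]_x f x.
Proof.
move=> nuK bf; have [mf [M fM]] := bf.
have bM : bounded_measurable (fun _ : E => M) by exact: bm_cst.
have bfM : bounded_measurable (fun x => f x + M) by exact: bmD.
have fM0 x : 0 <= f x + M.
  by rewrite -lerBlDr sub0r; have := fM x; rewrite ler_norml => /andP[].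
have M0 : 0 <= M by exact: le_trans (fM point).
have hnu := pos_linear_Rintegral nu.
have [+ _] := hnu; move=> lin.
have := stationary_ge0 _ _ _ nuK bfM fM0.
have -> : Kint K (fun x => f x + M) = (fun x => 1 * Kint K f x + Kint K (fun=> M) x).
  apply/funext => x; rewrite -(pos_linear_kernel K x).1//.
  by under [in RHS]eq_fun do rewrite mul1r.
rewrite lin; [|exact: bm_Kint..].
rewrite (stationary_ge0 _ _ _ nuK bM (fun=> M0)).
have -> : (fun x => f x + M) = (fun x => 1 * f x + M).
  by under [in RHS]eq_fun do rewrite mul1r.
by rewrite lin// !mul1r => /addIr.
Qed.

End Kernel.

(** * Positive operators and interpolation of their moment bounds *)

Section FeynmanKacOperators.
Context {R : realType} {d : measure_display} {E : measurableType d}.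
Implicit Types (f h : E -> R).

Definition positive_operator (Q : (E -> R) -> E -> R) : Prop :=
  (forall f, bounded_measurable f -> bounded_measurable (Q f)) /\
  (forall x, pos_linear (fun f => Q f x)).

Lemma positive_operator_norm Q f x : positive_operator Q ->
  bounded_measurable f -> `|Q f x| <= Q (fun y => `|f y|) x.
Proof. by move=> [_ hQ]; exact: pos_linear_norm (hQ x). Qed.

Lemma positive_operator_ge0 Q f : positive_operator Q ->
  bounded_measurable f -> (forall x, 0 <= f x) -> forall x, 0 <= Q f x.
Proof. by move=> [_ hQ] bf f0 x; exact: (hQ x).2. Qed.

Lemma positive_operator_id : positive_operator id.
Proof. by split => // x; split => // f _; exact. Qed.

Lemma positive_operator_comp Q S : positive_operator Q -> positive_operator S ->
  positive_operator (fun f => Q (S f)).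
Proof.
move=> hQ hS; split=> [f bf|x]; first exact/hQ.1/hS.1.
split=> [a f h bf bh|f bf f0].
  rewrite -(hQ.2 x).1; [|exact: hS.1..].
  by congr (Q _ x); apply/funext => y; exact: (hS.2 y).1.
apply: (hQ.2 x).2; [exact: hS.1|exact: positive_operator_ge0].
Qed.

Lemma positive_operator_mul f : bounded_measurable f -> (forall x, 0 <= f x) ->
  positive_operator (fun h x => f x * h x).
Proof.
move=> bf f0; split=> [h bh|x]; first exact: bmM.
split=> [a h k bh bk|h bh h0]; [by ring|by rewrite mulr_ge0].
Qed.

Lemma positive_operator_Kint (K : R.-pker E ~> E) :
  positive_operator (Kint K).
Proof. by split=> [f|x]; [exact: bm_Kint|exact: pos_linear_kernel]. Qed.

Lemma powR_interpolate_pointwise {a b c q0 q1 q s t : R} :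
  0 <= a -> 0 < q -> 1 - t = (1 - s) * q0 / q -> t * q = s * q1 ->
  a <= b `^ (1 - t) * c `^ t ->
  a `^ q <= (b `^ q0) `^ (1 - s) * (c `^ q1) `^ s.
Proof.
move=> a0 q_gt0 tE tq H.
have b0 := powR_ge0 b (1 - t); have c0 := powR_ge0 c t.
have := ge0_ler_powR (ltW q_gt0) a0 (mulr_ge0 b0 c0) H.
rewrite (powRM _ b0 c0) -!powRrM tE (divfK (lt0r_neq0 q_gt0)) tq.
by rewrite [(1 - s) * _]mulrC [s * _]mulrC.
Qed.

(** As [q] is the convex combination of [q0] and [q1] with weights [1 - s] and [s], the powers of
    [C] multiply to [C^q] and those of [M] to [M]. *)
Lemma powR_interpolate {C A B M q0 q1 q s : R} : 0 <= s <= 1 ->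
  q = (1 - s) * q0 + s * q1 -> 0 < q -> 0 <= C -> 0 <= A -> 0 <= B -> 0 <= M ->
  A <= C `^ q0 * M -> B <= C `^ q1 * M ->
  A `^ (1 - s) * B `^ s <= C `^ q * M.
Proof.
move=> /andP[s0 s1] qE q_gt0 C0 A0 B0 M0 HA HB.
have s1' : 0 <= 1 - s by rewrite subr_ge0.
have -> : C `^ q * M = (C `^ q0 * M) `^ (1 - s) * (C `^ q1 * M) `^ s.
  rewrite !(powRM _ (powR_ge0 _ _) M0) mulrACA -!powRrM.
  rewrite -powRD; last by rewrite [q0 * _]mulrC [q1 * _]mulrC -qE gt_eqF.
  rewrite -powRD; last by rewrite subrK oner_eq0.
  by rewrite subrK powRr1// [q0 * _]mulrC [q1 * _]mulrC -qE.
have HM r : 0 <= C `^ r * M by rewrite mulr_ge0// powR_ge0.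
by apply: ler_pM; rewrite ?powR_ge0//; apply: ge0_ler_powR; rewrite ?nnegrE.
Qed.

(* Riesz-Thorin for positive operators: for 1/q = (1-t)/q0 + t/q1 one writes
   |f| = (|f|^(q/q0))^(1-t) (|f|^(q/q1))^t and applies Hoelder's inequality
   first to Q(.)(x) and then to the measure. *)
Lemma positive_operator_interpolation Q (nu nu' : probability E R)
    (q0 q1 q C : R) : positive_operator Q ->
  0 < q0 -> q0 <= q -> q <= q1 -> 0 <= C ->
  (forall f, bounded_measurable f ->
     moment nu q0 (Q f) <= C `^ q0 * moment nu' q0 f) ->
  (forall f, bounded_measurable f ->
     moment nu q1 (Q f) <= C `^ q1 * moment nu' q1 f) ->
  forall f, bounded_measurable f ->
    moment nu q (Q f) <= C `^ q * moment nu' q f.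
Proof.
move=> hQ q00 q0q qq1 C0 H0 H1 f bf.
have q_gt0 : 0 < q by exact: lt_le_trans q0q.
have q1_gt0 : 0 < q1 by exact: lt_le_trans qq1.
(* Setting [q = q0] aside makes [q0 < q1] strict, so that [q1 - q0] can be a denominator. *)
have [->|nq] := eqVneq q q0; first exact: H0.
have q01 : q0 < q1 by rewrite (lt_le_trans _ qq1)// lt_neqAle eq_sym nq.
have q10 : 0 < q1 - q0 by rewrite subr_gt0.
pose s := (q - q0) / (q1 - q0).
have s01 : 0 <= s <= 1.
  apply/andP; split; first by rewrite divr_ge0// ?subr_ge0// (ltW q01).
  by rewrite ler_pdivrMr// mul1r lerB.
have [s0 s1] := andP s01.
have qE : q = (1 - s) * q0 + s * q1 by rewrite /s; field; rewrite gt_eqF.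
(* [s] locates [q] between [q0] and [q1], whereas [t] locates [1/q] between [1/q0] and [1/q1];
   Hoelder uses [t] under [Q] and [s] under [nu]. *)
pose t := s * q1 / q.
have tE : 1 - t = (1 - s) * q0 / q.
  rewrite /t -{1}(mulfV (lt0r_neq0 q_gt0)) -mulrBl; congr (_ / _).
  by rewrite {1}qE; ring.
have t01 : 0 <= t <= 1.
  apply/andP; split; first exact: divr_ge0 (mulr_ge0 s0 (ltW q1_gt0)) (ltW q_gt0).
  rewrite -subr_ge0 tE; apply: divr_ge0 (ltW q_gt0).
  by apply: mulr_ge0 (ltW q00); rewrite subr_ge0.
pose f0 x := `|f x| `^ (q / q0); pose f1 x := `|f x| `^ (q / q1).
have bf0 : bounded_measurable f0.
  by apply: bm_moment => //; rewrite divr_ge0 ?(ltW q_gt0) ?(ltW q00).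
have bf1 : bounded_measurable f1.
  by apply: bm_moment => //; rewrite divr_ge0 ?(ltW q_gt0) ?(ltW q1_gt0).
have f0_ge0 x : 0 <= f0 x by exact: powR_ge0.
have f1_ge0 x : 0 <= f1 x by exact: powR_ge0.
have Qf0 := positive_operator_ge0 _ _ hQ bf0 f0_ge0.
have Qf1 := positive_operator_ge0 _ _ hQ bf1 f1_ge0.
have absf : (fun x => `|f x|) = (fun x => f0 x `^ (1 - t) * f1 x `^ t).
  apply/funext => x; rewrite /f0 /f1 -!powRrM.
  have -> : q / q0 * (1 - t) = 1 - s.
    by rewrite tE; field; rewrite (gt_eqF q_gt0) (gt_eqF q00).
  have -> : q / q1 * t = s.
    by rewrite /t; field; rewrite (gt_eqF q_gt0) (gt_eqF q1_gt0).
  by rewrite -powRD ?subrK ?oner_eq0// powRr1.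
have pw x : `|Q f x| `^ q <=
    (`|Q f0 x| `^ q0) `^ (1 - s) * (`|Q f1 x| `^ q1) `^ s.
  rewrite (ger0_norm (Qf0 x)) (ger0_norm (Qf1 x)).
  have := positive_operator_norm _ _ x hQ bf; rewrite absf => /le_trans.
  move=> /(_ _ (pos_linear_hoelder _ _ _ _ (hQ.2 x) t01 bf0 bf1 f0_ge0 f1_ge0)).
  move=> H; apply: (powR_interpolate_pointwise (normr_ge0 _) q_gt0 tE _ H).
  by rewrite /t divfK// lt0r_neq0.
have bq (r : R) h : 0 < r -> bounded_measurable h ->
    bounded_measurable (fun x => `|Q h x| `^ r).
  by move=> r0 bh; apply: bm_moment; [exact: ltW|exact: hQ.1].
have hnu := pos_linear_Rintegral nu.
have pw0 (r : R) h x : 0 <= `|Q h x| `^ r by exact: powR_ge0.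
apply: (@le_trans _ _ (moment nu q0 (Q f0) `^ (1 - s) * moment nu q1 (Q f1) `^ s)).
  apply: le_trans (pos_linear_hoelder _ _ _ _ hnu s01
    (bq q0 f0 q00 bf0) (bq q1 f1 q1_gt0 bf1) (pw0 _ _) (pw0 _ _)).
  apply: (pos_linear_le _ _ _ hnu) => //; first exact: bq.
  by apply: bm_powR_prod => //; exact: bq.
(* The exponents of [f0] and [f1] are tuned so that both endpoint bounds involve the same [q]-th
   moment of [f]. *)
have m0 : moment nu' q0 f0 = moment nu' q f.
  by apply: eq_Rintegral => x _; rewrite ger0_norm// -powRrM divfK ?gt_eqF.
have m1 : moment nu' q1 f1 = moment nu' q f.
  by apply: eq_Rintegral => x _; rewrite ger0_norm// -powRrM divfK ?gt_eqF.
have := H0 _ bf0; have := H1 _ bf1; rewrite m0 m1 => B1 B0.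
exact: powR_interpolate s01 qE q_gt0 C0 (moment_ge0 _ _ _) (moment_ge0 _ _ _)
  (moment_ge0 _ _ _) B0 B1.
Qed.

End FeynmanKacOperators.

(** Propagators are unfolded at their left index, so inductions keep [k] fixed and descend in
    [j]. *)
Lemma nat_backward_ind (P : nat -> Prop) (l k : nat) : P k ->
  (forall j, (l <= j < k)%N -> P j.+1 -> P j) ->
  forall j, (l <= j <= k)%N -> P j.
Proof.
move=> Pk PS j /andP[lj jk]; move: lj; rewrite -(subKn jk).
elim: (k - j)%N => [_|m IH lm]; first by rewrite subn0.
have [mk|km] := ltnP m k.
  apply: PS; first by lia.
  have -> : ((k - m.+1).+1 = k - m)%N by lia.
  by apply: IH; lia.
(* For [k <= m] both truncated differences are 0. *)
have -> : (k - m.+1 = k - m)%N by lia.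
by apply: IH; lia.
Qed.

(** * The constants [delta] and their recursion *)

Section DeltaProduct.
Context {R : realType} (alpha gamma : R).

(** The product with a free number of factors, as the induction on the exponent requires;
    [delta alpha gamma r] is [delta_prod r.+1]. *)
Definition delta_prod (m : nat) : R :=
  \prod_(1 <= i < m.+1)
    (gamma `^ (1 - 2 ^- i.-1) /
     (1 - alpha * gamma ^+ (2 ^ i - 2)) `^ (2 ^- i)).

Lemma delta_prodS m : delta_prod m.+1 = delta_prod m *
  (gamma `^ (1 - 2 ^- m) /
     (1 - alpha * gamma ^+ (2 ^ m.+1 - 2)) `^ (2 ^- m.+1)).
Proof. by rewrite /delta_prod big_nat_recr. Qed.

Hypothesis hgamma : 1 < gamma.
Hypothesis halpha : 0 < alpha < 1.

Let gamma0 : 0 < gamma. Proof. exact: lt_trans hgamma. Qed.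

Lemma powR_double_pow2 m : gamma `^ (2 * 2 ^+ m - 2) = gamma ^+ (2 ^ m.+1 - 2).
Proof.
rewrite -(powR_mulrn _ (ltW gamma0)) natrB; last first.
  by rewrite expnS leq_pmulr ?expn_gt0.
by rewrite natrX exprS.
Qed.

(** Lets the smallness condition, assumed only at the top level, be used at every lower level of the
    induction. *)
Lemma alpha_gamma_anti m r : (m <= r)%N ->
  alpha * gamma ^+ (2 ^ r - 2) < 1 -> alpha * gamma ^+ (2 ^ m - 2) < 1.
Proof.
move=> mr; apply: le_lt_trans; have /andP[a0 _] := halpha.
rewrite ler_wpM2l ?(ltW a0)//; apply: ler_weXn2l; first exact: ltW.
by rewrite leq_sub2r// leq_exp2l.
Qed.

(** The numerator is a nonnegative power of [gamma > 1]; the denominator is a nonnegative power of a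
    number in [(0, 1]]. *)
Lemma delta_factor_ge1 m : alpha * gamma ^+ (2 ^ m.+1 - 2) < 1 ->
  1 <= gamma `^ (1 - 2 ^- m) /
     (1 - alpha * gamma ^+ (2 ^ m.+1 - 2)) `^ (2 ^- m.+1).
Proof.
move=> ag; have /andP[a0 _] := halpha.
have A0 : 0 < 1 - alpha * gamma ^+ (2 ^ m.+1 - 2) by rewrite subr_gt0.
rewrite ler_pdivlMr ?powR_gt0// mul1r; apply: (@le_trans _ _ 1).
  rewrite -[leRHS](powRr0 (1 - alpha * gamma ^+ (2 ^ m.+1 - 2))).
  apply: ger_powR; last by rewrite invr_ge0 exprn_ge0.
  by rewrite A0 lerBlDr lerDl mulr_ge0 ?exprn_ge0 ?(ltW a0) ?(ltW gamma0).
rewrite -[leLHS](powRr0 gamma); apply: ler_powR; first exact: ltW.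
by rewrite subr_ge0 invf_le1 ?exprn_gt0// exprn_ege1// ler1n.
Qed.

Lemma delta_prod_ge1 m : alpha * gamma ^+ (2 ^ m - 2) < 1 -> 1 <= delta_prod m.
Proof.
elim: m => [_|m IH ag]; first by rewrite /delta_prod big_nil.
rewrite delta_prodS -[leLHS]mulr1 ler_pM ?delta_factor_ge1//.
by apply: IH; exact: alpha_gamma_anti ag.
Qed.

(** With [p = 2^m] and [G = gamma^(2p-2)], this is the recursion [D -> G / (1 - alpha G) * D^2] from
    the constant of the [p]-th moments to that of the [2p]-th. Taking roots of order [2p] produces
    the factors of [delta]. *)
Lemma delta_prodS_powR m : alpha * gamma ^+ (2 ^ m.+1 - 2) < 1 ->
  delta_prod m.+1 `^ (2 * 2 ^+ m) =
  gamma `^ (2 * 2 ^+ m - 2) / (1 - alpha * gamma `^ (2 * 2 ^+ m - 2)) *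
    (delta_prod m `^ (2 ^+ m)) ^+ 2.
Proof.
move=> ag; have gE := powR_double_pow2 m.
have D0 : 0 <= delta_prod m.
  by rewrite (le_trans ler01)// delta_prod_ge1// (alpha_gamma_anti m m.+1).
have A0 : 0 < 1 - alpha * gamma ^+ (2 ^ m.+1 - 2) by rewrite subr_gt0.
have m0 : 2 ^+ m != 0 :> R by rewrite expf_neq0.
rewrite delta_prodS powRM//; last by rewrite divr_ge0// powR_ge0.
rewrite mulrC; congr (_ * _); last first.
  by rewrite -(powR_mulrn 2 (powR_ge0 _ _)) -powRrM [_ * 2]mulrC.
rewrite powRM ?powR_ge0 ?invr_ge0 ?powR_ge0// -(powR_inv1 (powR_ge0 _ _)) -!powRrM.
have -> : (1 - 2 ^- m) * (2 * 2 ^+ m) = 2 * 2 ^+ m - 2 :> R by field.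
have -> : 2 ^- m.+1 * (-1 * (2 * 2 ^+ m)) = -1 :> R by rewrite exprS; field.
by rewrite (powR_inv1 (ltW A0)) gE.
Qed.

End DeltaProduct.

(** [C] is a fixed point of [c -> G (alpha c + D^2)], so one more propagation step reproduces the
    same constant. *)
Lemma double_step_ineq {R : realFieldType} {alpha G C D M a b y : R} :
  0 < alpha -> 0 < G -> alpha * G * C + G * D ^+ 2 = C ->
  0 <= b -> 0 <= y -> a <= C * M -> b ^+ 2 <= M -> y <= D * b ->
  G * (alpha * a + y ^+ 2) <= C * M.
Proof.
move=> a0 G0 CE b0 y0 aCM bM yb.
have y2 : y ^+ 2 <= D ^+ 2 * M.
  apply: (@le_trans _ _ ((D * b) ^+ 2)).
    by rewrite lerXn2r ?nnegrE ?(le_trans y0).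
  by rewrite exprMn ler_wpM2l// sqr_ge0.
have -> : C * M = G * (alpha * (C * M) + D ^+ 2 * M) by rewrite -{1}CE; ring.
by rewrite ler_wpM2l ?(ltW G0)// lerD// ler_wpM2l// ltW.
Qed.

(** * Factorization of the propagators *)

Section Propagators.
Context {R : realType} {d : measure_display} {E : measurableType d}.
Context (n : nat) (mu : nat -> probability E R) (K : nat -> R.-pker E ~> E)
  (g : nat -> E -> R).
Implicit Types (f h : E -> R).

(** The product of the modified one-step propagators with indices [j+1, ..., k], encoded like
    [qprop]. *)
Definition qhatprop (j k : nat) f : E -> R :=
  foldr (qhat mu g K) f (iota j.+1 (k - j)).

Lemma qhatprop_id k f : qhatprop k k f = f.
Proof. by rewrite /qhatprop subnn. Qed.

Lemma qhatprop_rec j k f : (j < k)%N ->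
  qhatprop j k f = qhat mu g K j.+1 (qhatprop j.+1 k f).
Proof. by move=> jk; rewrite /qhatprop -(subnSK jk). Qed.

Lemma qprop_rec j k f : (j < k)%N ->
  qprop mu g K j k f = qstep mu g K j.+1 (qprop mu g K j.+1 k f).
Proof. by move=> jk; rewrite /qprop -(subnSK jk). Qed.

(** Rebracketing pairs each inner kernel [K_i] with the next weight [gbar_{i+1}] into [qhat_{i+1}];
    the first weight and the last kernel remain. *)
Lemma qprop_qhatprop j k f : (j < k)%N ->
  qprop mu g K j k f =
  (fun x => gbar mu g j.+1 x * qhatprop j.+1 k (Kint (K k) f) x).
Proof.
case: k => [//|k]; rewrite ltnS => jk.
(* [k] now denotes the predecessor of the right index, so the base case [j = k] is a single step. *)
move: j {jk}(jk : (0 <= j <= k)%N); apply: nat_backward_ind => [|j /= jk IH].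
  by rewrite qprop_rec// /qprop subnn qhatprop_id.
by rewrite (qprop_rec _ _ _ (leqW jk)) IH (qhatprop_rec j.+1).
Qed.

(** * Positivity and change of measure *)

Hypothesis hK : forall k : nat, (1 <= k <= n)%N -> stationary (mu k) (K k).
Hypothesis hgB : forall k : nat, (1 <= k <= n)%N -> bounded_measurable (g k).
Hypothesis hgpos : forall k : nat, (1 <= k <= n)%N -> forall x : E, 0 < g k x.
Hypothesis hmu : forall k : nat, (1 <= k <= n)%N ->
    forall f : E -> R, bounded_measurable f ->
    \int[mu k]_x f x =
      (\int[mu k.-1]_x (g k x * f x)) / (\int[mu k.-1]_x g k x).

Lemma bm_gbar k : (1 <= k <= n)%N -> bounded_measurable (gbar mu g k).
Proof. by move=> kn; apply: bmM; [exact: hgB|exact: bm_cst]. Qed.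

Lemma gbar_ge0 k : (1 <= k <= n)%N -> forall x, 0 <= gbar mu g k x.
Proof.
move=> kn x; rewrite /gbar divr_ge0 ?(ltW (hgpos _ kn x))//.
by apply: Rintegral_ge0 => y _; exact: ltW (hgpos _ kn y).
Qed.

(** [gbar] is the density of [mu k] with respect to [mu k.-1]. *)
Lemma Rintegral_gbar k f : (1 <= k <= n)%N -> bounded_measurable f ->
  \int[mu k.-1]_x (gbar mu g k x * f x) = \int[mu k]_x f x.
Proof.
move=> kn bf; rewrite (hmu _ kn _ bf) mulrC.
have bgf : bounded_measurable (fun x => g k x * f x).
  by apply: bmM => //; exact: hgB.
rewrite -(pos_linearZ _ _ _ (pos_linear_Rintegral (mu k.-1)) bgf).
by apply: eq_Rintegral => x _; rewrite /gbar mulrA [_^-1 * _]mulrC.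
Qed.

Lemma positive_operator_qhat k : (1 <= k <= n)%N ->
  positive_operator (qhat mu g K k).
Proof.
move=> kn; apply: (positive_operator_comp (Kint (K k.-1)) _).
  exact: positive_operator_Kint.
by apply: positive_operator_mul; [exact: bm_gbar|exact: gbar_ge0].
Qed.

Lemma positive_operator_qhatprop j k : (j <= k <= n)%N ->
  positive_operator (qhatprop j k).
Proof.
move=> /andP[jk kn].
move: j {jk}(jk : (0 <= j <= k)%N); apply: nat_backward_ind => [|j /= jk IH].
  have -> : qhatprop k k = id by apply/funext => f; exact: qhatprop_id.
  exact: positive_operator_id.
have -> : qhatprop j k = (fun f => qhat mu g K j.+1 (qhatprop j.+1 k f)).
  by apply/funext => f; rewrite qhatprop_rec.
apply: positive_operator_comp => //; apply: positive_operator_qhat.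
exact: leq_trans jk kn.
Qed.

(** Stationarity removes [K k.-1], then the density turns [mu k.-1] into [mu k]. The bound [2 <= k]
    is needed because stationarity starts at index 1. *)
Lemma Rintegral_qhat k f : (2 <= k <= n)%N -> bounded_measurable f ->
  \int[mu k.-1]_x qhat mu g K k f x = \int[mu k]_x f x.
Proof.
move=> kn bf; rewrite /qhat stationary_Rintegral.
- by rewrite Rintegral_gbar//; lia.
- by apply: hK; lia.
- by apply: bmM => //; apply: bm_gbar; lia.
Qed.

Lemma Rintegral_qhatprop j k f : (1 <= j <= k)%N -> (k <= n)%N ->
  bounded_measurable f -> \int[mu j]_x qhatprop j k f x = \int[mu k]_x f x.
Proof.
move=> jk kn bf; move: j jk; apply: nat_backward_ind => [|j /andP[j0 jk] <-].
  by rewrite qhatprop_id.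
have jn : (2 <= j.+1 <= n)%N by rewrite ltnS j0 (leq_trans jk).
rewrite qhatprop_rec// (Rintegral_qhat j.+1)//.
by apply: (positive_operator_qhatprop _ _ _).1 => //; rewrite jk.
Qed.

(** * Estimates from the bound [gamma] on the weights *)

Context (gamma : R).
Hypothesis hgamma : 1 < gamma.
Hypothesis hgbar : forall k : nat, (1 <= k <= n)%N ->
    forall x : E, gbar mu g k x <= gamma.

Let gamma0 : 0 < gamma. Proof. exact: lt_trans hgamma. Qed.

(** One factor is kept to serve as a density; the remaining power [p - 1] is bounded through
    [gamma]. *)
Lemma gbar_powR (p : R) k x : 1 <= p -> (1 <= k <= n)%N ->
  gbar mu g k x `^ p <= gamma `^ (p - 1) * gbar mu g k x.
Proof.
move=> p1 kn; have g0 := gbar_ge0 _ kn x.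
rewrite -(mulr_powRB1 g0 (lt_le_trans ltr01 p1)) mulrC ler_wpM2r//.
by apply: ge0_ler_powR; rewrite ?nnegrE ?subr_ge0 ?(ltW gamma0) ?hgbar.
Qed.

Lemma moment_gbarM (p : R) k h : 1 <= p -> (1 <= k <= n)%N ->
  bounded_measurable h ->
  moment (mu k.-1) p (fun x => gbar mu g k x * h x) <=
  gamma `^ (p - 1) * moment (mu k) p h.
Proof.
move=> p1 kn bh; have p0 : 0 <= p by exact: le_trans p1.
have bhp := bm_moment _ _ p0 bh.
rewrite /moment -(Rintegral_gbar _ _ kn bhp).
have bghp := bmM _ _ (bm_gbar _ kn) bhp.
have hnu := pos_linear_Rintegral (mu k.-1).
rewrite -(pos_linearZ _ _ _ hnu bghp); apply: (pos_linear_le _ _ _ hnu).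
- by apply: bm_moment => //; apply: bmM => //; exact: bm_gbar.
- by apply: bmM => //; exact: bm_cst.
move=> x; have g0 := gbar_ge0 _ kn x.
rewrite normrM (ger0_norm g0) powRM// mulrA ler_wpM2r ?powR_ge0//.
exact: gbar_powR.
Qed.

(** Jensen for the probability [K k.-1 x], followed by [gbar_powR] inside the integral. *)
Lemma qhat_powR (p : R) k f x : 1 <= p -> (1 <= k <= n)%N ->
  bounded_measurable f ->
  `|qhat mu g K k f x| `^ p <=
  gamma `^ (p - 1) * qhat mu g K k (fun y => `|f y| `^ p) x.
Proof.
move=> p1 kn bf; have p0 : 0 <= p by exact: le_trans p1.
have bfp := bm_moment _ _ p0 bf.
have hL := pos_linear_kernel (K k.-1) x.
have bgf := bmM _ _ (bm_gbar _ kn) bf.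
have bgfp := bmM _ _ (bm_gbar _ kn) bfp.
apply: le_trans (pos_linear_jensen _ _ _ hL (Kint_cst _ _ _) p1 bgf) _.
rewrite /qhat -(pos_linearZ _ _ _ hL bgfp); apply: (pos_linear_le _ _ _ hL).
- exact: bm_moment.
- by apply: bmM => //; exact: bm_cst.
move=> y; have g0 := gbar_ge0 _ kn y.
rewrite normrM (ger0_norm g0) powRM// mulrA ler_wpM2r ?powR_ge0//.
exact: gbar_powR.
Qed.

(** * Moment bounds by doubling the exponent, and interpolation *)

Context (alpha beta : R).
Hypothesis halpha : 0 < alpha < 1.
Hypothesis hbeta : 0 <= beta <= 1.
Hypothesis hqhat : forall k : nat, (2 <= k <= n)%N ->
    forall f : E -> R, bounded_measurable f ->
    ('N[mu k.-1]_2%:E[EFin \o qhat mu g K k f] ^+ 2 <=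
      alpha%:E * 'N[mu k]_2%:E[EFin \o f] ^+ 2 +
      (beta * (\int[mu k]_x f x) ^+ 2)%:E)%E.

Lemma moment2_qhat k f : (2 <= k <= n)%N -> bounded_measurable f ->
  moment (mu k.-1) 2 (qhat mu g K k f) <=
  alpha * moment (mu k) 2 f + (\int[mu k]_x f x) ^+ 2.
Proof.
move=> kn bf; have kn1 : (1 <= k <= n)%N by lia.
have := hqhat _ kn _ bf.
rewrite !Lnorm_moment//; last exact: (positive_operator_qhat _ kn1).1.
have sq (a : R) : 0 <= a -> ((a `^ 2^-1)%:E ^+ 2 = a%:E)%E.
  by move=> a0; rewrite -EFin_expe powR12_sqrt// sqr_sqrtr.
rewrite !sq ?moment_ge0// -EFinM -EFinD lee_fin => /le_trans; apply.
by rewrite lerD2l ler_piMl ?sqr_ge0//; case/andP: hbeta.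
Qed.

(** The pointwise bound on [|qhat f|^p] is squared and integrated; the [L_2] hypothesis is then used
    for [|f|^p], whose mean is the [p]-th moment of [f]. *)
Lemma moment_double_qhat (p : R) k f : 1 <= p -> (2 <= k <= n)%N ->
  bounded_measurable f ->
  moment (mu k.-1) (2 * p) (qhat mu g K k f) <=
  gamma `^ (2 * p - 2) *
    (alpha * moment (mu k) (2 * p) f + moment (mu k) p f ^+ 2).
Proof.
move=> p1 kn bf; have kn1 : (1 <= k <= n)%N by lia.
have p0 : 0 <= p by exact: le_trans p1.
have bfp := bm_moment _ _ p0 bf.
have := moment2_qhat _ _ kn bfp.
have -> : moment (mu k) 2 (fun x => `|f x| `^ p) = moment (mu k) (2 * p) f.
  by apply: eq_Rintegral => x _; rewrite ger0_norm ?powR_ge0// -powRrM mulrC.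
move=> /(ler_wpM2l (powR_ge0 gamma (2 * p - 2))); apply: le_trans.
have hQ := positive_operator_qhat _ kn1.
have b2 := bm_moment 2 _ (ler0n _ _) (hQ.1 _ bfp).
have hnu := pos_linear_Rintegral (mu k.-1).
rewrite /moment -(pos_linearZ _ _ _ hnu b2); apply: (pos_linear_le _ _ _ hnu).
- by apply: bm_moment; [rewrite mulr_ge0|exact: hQ.1].
- by apply: bmM => //; exact: bm_cst.
move=> x; have q0 := positive_operator_ge0 _ _ hQ bfp (fun y => powR_ge0 _ _) x.
have := qhat_powR _ _ _ x p1 kn1 bf.
move=> /(ge0_ler_powR (ler0n R 2) (powR_ge0 _ _) (mulr_ge0 (powR_ge0 _ _) q0)).
rewrite (powRM _ (powR_ge0 _ _) q0) -!powRrM (ger0_norm q0) mulrBl mul1r.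
by rewrite ![_ * 2]mulrC.
Qed.

(** Iterating the one-step bound gives an affine recursion with slope [alpha G < 1]; its fixed point
    is a constant uniform in [j] and [k]. *)
Lemma moment_double_qhatprop (p D : R) k : 1 <= p -> 1 <= D ->
  alpha * gamma `^ (2 * p - 2) < 1 -> (k <= n)%N ->
  (forall j f, (1 <= j <= k)%N -> bounded_measurable f ->
    moment (mu j) p (qhatprop j k f) <= D * moment (mu k) p f) ->
  forall j f, (1 <= j <= k)%N -> bounded_measurable f ->
    moment (mu j) (2 * p) (qhatprop j k f) <=
    gamma `^ (2 * p - 2) / (1 - alpha * gamma `^ (2 * p - 2)) * D ^+ 2 *
      moment (mu k) (2 * p) f.
Proof.
move=> p1 D1; set G := gamma `^ (2 * p - 2) => aG kn Hp j f jk bf.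
have G1 : 1 <= G.
  rewrite -(powRr0 gamma) ler_powR ?(ltW hgamma)// subr_ge0.
  by rewrite -[leLHS]mulr1 ler_pM2l.
have G0 : 0 < G by exact: lt_le_trans G1.
have a0 : 0 < alpha by case/andP: halpha.
have A0 : 0 < alpha * G by rewrite mulr_gt0.
have A1 : 0 < 1 - alpha * G by rewrite subr_gt0.
set C := G / _ * _.
have CE : alpha * G * C + G * D ^+ 2 = C by rewrite /C; field; rewrite gt_eqF.
(* Needed for the base case [j = k], where the propagator is the identity. *)
have C1 : 1 <= C.
  rewrite /C -[leLHS]mulr1 ler_pM ?exprn_ege1// ler_pdivlMr// mul1r.
  by rewrite (le_trans _ G1)// lerBlDr lerDl ltW.
have M0 := moment_ge0 (mu k) (2 * p) f.
move: j jk; apply: nat_backward_ind => [|j /andP[j0 jk] IH].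
  by rewrite qhatprop_id ler_peMl.
have jn : (2 <= j.+1 <= n)%N by rewrite ltnS j0 (leq_trans jk).
have p0 : 0 < p by exact: lt_le_trans p1.
have bQf : bounded_measurable (qhatprop j.+1 k f).
  by apply: (positive_operator_qhatprop _ _ _).1 => //; rewrite jk.
rewrite qhatprop_rec//.
apply: le_trans (moment_double_qhat p j.+1 _ p1 jn bQf) _.
have := Hp j.+1 f jk bf.
(* The source term contributes the square of the [p]-th moment of [f], which the [2p]-th moment
   dominates. *)
have := moment_jensen (mu k) p (2 * p) f p0.
have p2p : p <= 2 * p by rewrite ler_peMl ?(ltW p0)// ler1n.
rewrite (mulfK (lt0r_neq0 p0)) => /(_ p2p bf).
rewrite (powR_mulrn 2 (moment_ge0 _ _ _)).
move: (moment_ge0 (mu k) p f) (moment_ge0 (mu j.+1) p (qhatprop j.+1 k f)) IH.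
rewrite -/G => b0 y0 IH bM yb.
exact: double_step_ineq a0 G0 CE b0 y0 IH bM yb.
Qed.

(** Positivity gives [|Q f| <= Q |f|], and [Q] carries the integral under [mu j] to that under
    [mu k]. *)
Lemma moment1_qhatprop j k f : (1 <= j <= k)%N -> (k <= n)%N ->
  bounded_measurable f ->
  moment (mu j) 1 (qhatprop j k f) <= moment (mu k) 1 f.
Proof.
move=> jk kn bf; have jkn : (j <= k <= n)%N by case/andP: jk => _ ->.
have hQ := positive_operator_qhatprop _ _ jkn.
have bf1 := bm_moment 1 _ ler01 bf.
rewrite /moment -(Rintegral_qhatprop _ _ _ jk kn bf1).
apply: (pos_linear_le _ _ _ (pos_linear_Rintegral (mu j))).
- by apply: bm_moment => //; exact: hQ.1.
- exact: hQ.1.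
move=> x; rewrite powRr1//.
have -> : (fun y => `|f y| `^ 1) = (fun y => `|f y|).
  by apply/funext => y; rewrite powRr1.
exact: positive_operator_norm.
Qed.

Lemma moment_pow2_qhatprop m k : (k <= n)%N ->
  alpha * gamma ^+ (2 ^ m - 2) < 1 ->
  forall j f, (1 <= j <= k)%N -> bounded_measurable f ->
    moment (mu j) (2 ^+ m) (qhatprop j k f) <=
    delta_prod alpha gamma m `^ (2 ^+ m) * moment (mu k) (2 ^+ m) f.
Proof.
move=> kn; elim: m => [_ j f jk bf|m IH ag].
  by rewrite expr0 /delta_prod big_nil powR1 mul1r; exact: moment1_qhatprop.
have ag' := alpha_gamma_anti _ _ hgamma halpha m m.+1 (leqnSn m) ag.
have d1 := delta_prod_ge1 _ _ hgamma halpha _ ag'.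
rewrite exprS => j f; rewrite (delta_prodS_powR _ _ hgamma halpha _ ag).
apply: moment_double_qhatprop => //.
- by rewrite exprn_ege1// ler1n.
- have m1 : 0 <= 2 ^+ m :> R by rewrite exprn_ge0.
  by rewrite -[leLHS](powRr0 (delta_prod alpha gamma m)) ler_powR.
- by rewrite powR_double_pow2.
- exact: IH.
Qed.

(** Interpolates between the exponents [2^r] and [2^(r+1)]. A common constant is required at both
    ends, and [delta] serves since its factors are at least 1. *)
Lemma moment_qhatprop (q : R) r j k f : 2 ^+ r <= q <= 2 ^+ r.+1 ->
  alpha * gamma ^+ (2 ^ r.+1 - 2) < 1 -> (1 <= j <= k)%N -> (k <= n)%N ->
  bounded_measurable f ->
  moment (mu j) q (qhatprop j k f) <=
  delta alpha gamma r `^ q * moment (mu k) q f.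
Proof.
move=> /andP[rq qr] ag jk kn.
have jkn : (j <= k <= n)%N by case/andP: jk => _ ->.
have ag' := alpha_gamma_anti _ _ hgamma halpha r r.+1 (leqnSn r) ag.
have d1 := delta_prod_ge1 _ _ hgamma halpha _ ag'.
have d0 := le_trans ler01 d1.
have d2 : delta_prod alpha gamma r <= delta alpha gamma r.
  rewrite -[delta _ _ _]/(delta_prod alpha gamma r.+1) delta_prodS.
  by rewrite (ler_peMr d0)// delta_factor_ge1.
have d3 := le_trans d0 d2.
have r0 : 0 < 2 ^+ r :> R by rewrite exprn_gt0.
apply: (positive_operator_interpolation _ _ _ _ _ _ _
  (positive_operator_qhatprop _ _ jkn) r0 rq qr d3) => h bh.
  apply: le_trans (moment_pow2_qhatprop _ _ kn ag' _ _ jk bh) _.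
  apply: ler_wpM2r; first exact: moment_ge0.
  exact: ge0_ler_powR (ltW r0) _ _ d0 d3 d2.
exact: moment_pow2_qhatprop.
Qed.

(** Factors are peeled off from the left: a weight, the kernel giving [theta], a second weight, then
    the modified propagator and the last kernel. *)
Lemma qprop_Lp_bound (p q theta : R) r : 1 <= p -> 1 <= q ->
  2 ^+ r <= q <= 2 ^+ r.+1 -> alpha * gamma ^+ (2 ^ r.+1 - 2) < 1 ->
  0 <= theta ->
  (forall j : nat, (1 <= j <= n)%N ->
    forall f : E -> R, bounded_measurable f ->
    ('N[mu j]_p%:E[EFin \o Kint (K j) f] <=
      theta%:E * 'N[mu j]_q%:E[EFin \o f])%E) ->
  forall j k : nat, (1 <= j)%N -> (j < k)%N -> (k <= n)%N ->
  forall f : E -> R, bounded_measurable f ->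
  ('N[mu j]_p%:E[EFin \o qprop mu g K j k f] <=
    (ctilde alpha gamma theta p q r)%:E * 'N[mu k]_q%:E[EFin \o f])%E.
Proof.
move=> p1 q1 hr ag theta0 hyper j k j1 jk kn f bf.
have p0 : 0 < p by exact: lt_le_trans p1.
have q0 : 0 < q by exact: lt_le_trans q1.
have hyper' i h : (1 <= i <= n)%N -> bounded_measurable h ->
    moment (mu i) p (Kint (K i) h) `^ p^-1 <=
    theta * moment (mu i) q h `^ q^-1.
  move=> hi bh; have := hyper i hi h bh.
  rewrite (Lnorm_moment _ _ _ (ltW p0) (bm_Kint _ _ bh)).
  by rewrite (Lnorm_moment _ _ _ (ltW q0) bh) -EFinM lee_fin.
(* Passing from moments to norms turns the cost [gamma^(s-1)] of a change of measure into
   [gamma^((s-1)/s)]. *)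
have root (s a b : R) : 1 <= s -> 0 <= a -> 0 <= b -> a <= gamma `^ (s - 1) * b ->
    a `^ s^-1 <= gamma `^ ((s - 1) / s) * b `^ s^-1.
  move=> s1 a0 b0 ab; have s0 := lt_le_trans ltr01 s1.
  rewrite powRrM -(powRM _ (powR_ge0 _ _) b0).
  apply: ge0_ler_powR; rewrite ?nnegrE ?invr_ge0 ?(ltW s0)//.
  by rewrite mulr_ge0 ?powR_ge0.
have j1n : (1 <= j.+1 <= n)%N by exact: leq_trans jk kn.
have k1n : (1 <= k <= n)%N by rewrite kn (leq_trans _ jk).
have bKf := bm_Kint (K k) _ bf.
set M := moment (mu k) q f.
(* The last kernel contracts [L_q] of its stationary measure, by Jensen and stationarity. *)
have KM : moment (mu k) q (Kint (K k) f) <= M.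
  rewrite /M /moment -(stationary_Rintegral _ _ _ (hK _ k1n) (bm_moment _ _ (ltW q0) bf)).
  apply: (pos_linear_le _ _ _ (pos_linear_Rintegral (mu k))).
  - exact: bm_moment (ltW q0) bKf.
  - exact: bm_Kint (bm_moment _ _ (ltW q0) bf).
  - move=> x; exact: pos_linear_jensen (pos_linear_kernel _ _) (Kint_cst _ _ _) q1 bf.
have jkn : (j.+1 <= k <= n)%N by rewrite jk.
have bQ := (positive_operator_qhatprop _ _ jkn).1 _ bKf.
have bq : bounded_measurable (qprop mu g K j k f).
  by rewrite qprop_qhatprop//; apply: bmM => //; exact: bm_gbar.
rewrite (Lnorm_moment _ _ _ (ltW p0) bq) (Lnorm_moment _ _ _ (ltW q0) bf).
rewrite -EFinM lee_fin qprop_qhatprop//.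
have M0 : 0 <= M by exact: moment_ge0.
(* The leftmost weight turns [mu j] into [mu j.+1]. *)
apply: le_trans (root p _ _ p1 (moment_ge0 _ _ _) (moment_ge0 _ _ _)
  (moment_gbarM _ _ _ p1 j1n bQ)) _.
rewrite /ctilde -/M.
have -> : theta * gamma `^ ((p - 1) / p) * gamma `^ ((q - 1) / q) *
    delta alpha gamma r * M `^ q^-1 = gamma `^ ((p - 1) / p) *
    (theta * (gamma `^ ((q - 1) / q) * (delta alpha gamma r * M `^ q^-1))) by ring.
apply: ler_wpM2l; first exact: powR_ge0.
have d1 : 1 <= delta alpha gamma r.
  exact: (delta_prod_ge1 _ _ hgamma halpha r.+1 ag).
have d0 := le_trans ler01 d1.
have gq1 : 1 <= gamma `^ ((q - 1) / q).
  rewrite -[leLHS](powRr0 gamma); apply: ler_powR; first exact: ltW.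
  by rewrite divr_ge0 ?subr_ge0// ltW.
(* For [k = j + 1] only the kernel [K k] is left: [theta] suffices and the surplus factors are at
   least 1. *)
move: jk; rewrite leq_eqVlt => /predU1P[jk|jk].
  rewrite -jk qhatprop_id; apply: le_trans (hyper' _ _ j1n bf) _.
  apply: (ler_wpM2l theta0); rewrite mulrA jk -/M.
  by apply: ler_peMl; [exact: powR_ge0|exact: mulr_ege1].
have j2n : (1 <= j.+2 <= n)%N by exact: leq_trans jk kn.
have j2kn : (j.+2 <= k <= n)%N by rewrite jk.
have bQ2 := (positive_operator_qhatprop _ _ j2kn).1 _ bKf.
(* The leading [qhat] consists of [K j.+1], which passes from [L_p] to [L_q] at the cost [theta],
   and of a weight, which turns [mu j.+1] into [mu j.+2]. *)
rewrite qhatprop_rec//.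
have bgQ := bmM _ _ (bm_gbar _ j2n) bQ2.
apply: le_trans (hyper' _ _ j1n bgQ) _; apply: (ler_wpM2l theta0).
apply: le_trans (root q _ _ q1 (moment_ge0 _ _ _) (moment_ge0 _ _ _)
  (moment_gbarM _ _ _ q1 j2n bQ2)) _.
apply: ler_wpM2l; first exact: powR_ge0.
have dq0 : 0 <= delta alpha gamma r `^ q by exact: powR_ge0.
have -> : delta alpha gamma r * M `^ q^-1 =
    (delta alpha gamma r `^ q * M) `^ q^-1.
  by rewrite (powRM _ dq0 M0) -powRrM mulfV ?gt_eqF// powRr1.
have q'0 : 0 <= q^-1 by rewrite invr_ge0 ltW.
have jk' : (1 <= j.+2 <= k)%N by exact: jk.
have H := le_trans (moment_qhatprop _ _ _ _ _ hr ag jk' kn bKf)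
  (ler_wpM2l dq0 KM).
exact: ge0_ler_powR q'0 _ _ (moment_ge0 _ _ _) (mulr_ge0 dq0 M0) H.
Qed.

End Propagators.

Theorem corollary4p9 (R : realType) (E : ptopologicalType) (hE : polish R E)
  (n : nat)
  (mu : nat -> probability (borel E) R)
  (K : nat -> R.-pker (borel E) ~> (borel E))
  (g : nat -> borel E -> R)
  (hK : forall k : nat, (1 <= k <= n)%N -> stationary (mu k) (K k))
  (hgB : forall k : nat, (1 <= k <= n)%N -> bounded_measurable (g k))
  (hgpos : forall k : nat, (1 <= k <= n)%N -> forall x : E, 0 < g k x)
  (hmu : forall k : nat, (1 <= k <= n)%N ->
    forall f : borel E -> R, bounded_measurable f ->
    \int[mu k]_x f x =
      (\int[mu k.-1]_x (g k x * f x)) / (\int[mu k.-1]_x g k x))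
  (gamma alpha beta : R)
  (hgamma : 1 < gamma)
  (hgbar : forall k : nat, (1 <= k <= n)%N ->
    forall x : E, gbar mu g k x <= gamma)
  (halpha : 0 < alpha < 1) (hbeta : 0 <= beta <= 1)
  (hqhat : forall k : nat, (2 <= k <= n)%N ->
    forall f : borel E -> R, bounded_measurable f ->
    ('N[mu k.-1]_2%:E[EFin \o qhat mu g K k f] ^+ 2 <=
      alpha%:E * 'N[mu k]_2%:E[EFin \o f] ^+ 2 +
      (beta * (\int[mu k]_x f x) ^+ 2)%:E)%E)
  (p q : R) (hp : 1 <= p) (hq : 1 <= q)
  (r : nat) (hr : 2 ^+ r <= q <= 2 ^+ r.+1)
  (hag : alpha * gamma ^+ (2 ^ r.+1 - 2) < 1)
  (theta : R) (htheta : 0 <= theta)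
  (hhyper : forall j : nat, (1 <= j <= n)%N ->
    forall f : borel E -> R, bounded_measurable f ->
    ('N[mu j]_p%:E[EFin \o Kint (K j) f] <=
      theta%:E * 'N[mu j]_q%:E[EFin \o f])%E) :
  forall j k : nat, (1 <= j)%N -> (j < k)%N -> (k <= n)%N ->
  forall f : borel E -> R, bounded_measurable f ->
  ('N[mu j]_p%:E[EFin \o qprop mu g K j k f] <=
    (ctilde alpha gamma theta p q r)%:E * 'N[mu k]_q%:E[EFin \o f])%E.
Proof.
exact: (qprop_Lp_bound n mu K g hK hgB hgpos hmu gamma hgamma hgbar alpha beta
  halpha hbeta hqhat p q theta r hp hq hr hag htheta hhyper).
Qed.
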